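(* Let $(\mathcal{P},\gamma,m)$ be an operad with multiplication and let $G^{inv}$, $\cdot$, $\times$, $\curvearrowleft$, $\curvearrowright$, $\lambda$, $\boxtimes$, $I$ be as defined in the context. Let $k_a,k_b\in G^{inv}$ and let $t_a,t_b\in G^{inv}$ be such that the following fixed point equations hold in $G^{inv}$: $$k_a = t_a\curvearrowleft \lambda(k_a),\qquad k_b = t_b\curvearrowleft\lambda(k_b).$$ Then $$k_a\boxtimes k_b = \Big(\big[t_a\curvearrowleft (t_b\curvearrowright I)\big]\cdot t_b\Big)\curvearrowleft \lambda(k_a\boxtimes k_b).$$
   Context: $\mathcal{P}=(P,\gamma)$ is a planar (non-symmetric) operad in complex vector spaces, with $P=(P(n))_{n\ge 1}$ (no operators of arity $0$), unit $\mathrm{id}\in P(1)$ and composition $\gamma(p\otimes q_1\otimes\cdots\otimes q_n)$ for $p\in P(n)$. A multiplication is an element $m\in P(2)$ with $\gamma(m\otimes \mathrm{id}\otimes m)=\gamma(m\otimes m\otimes \mathrm{id})$. Formal series: $\mathbb{C}[[\mathcal{P}]]=\prod_{n\ge1}P(n)$; the component of $x$ in $P(n)$ is $x_n$. The element $I\in\mathbb{C}[[\mathcal P]]$ is the series with $I_1=\mathrm{id}$ and $I_n=0$ for $n\ge2$. Composition product: for $x,y\in\mathbb{C}[[\mathcal{P}]]$, $x\times y=\sum_{n\ge1}\sum_{m_1,\dots,m_n\ge1}\gamma(x_n\otimes y_{m_1}\otimes\cdots\otimes y_{m_n})$ (the summand has arity $m_1+\cdots+m_n$). Concatenation product: $(x\cdot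 y)_n=\sum_{k+q=n,\ k,q\ge1}\gamma(m\otimes x_k\otimes y_q)$. Let $\mathbb{C}[[\mathcal{P}]]_0=\mathbb{C}1\oplus\mathbb{C}[[\mathcal{P}]]$ be its unitization, where $1$ is a unit for $\cdot$, of degree $0$. $G=\{x\in\mathbb{C}[[\mathcal{P}]]: x_1=\mathrm{id}\}$, a group for $\times$ with unit $I$. $G^{inv}=\{x\in\mathbb{C}[[\mathcal{P}]]_0: x_0=1\}$, a group for $\cdot$ with unit $1$; inverses $h^{-1}$ of $h\in G^{inv}$ are for $\cdot$. Right action of $G$ on $G^{inv}$: $h\curvearrowleft g=h\times g$, where $\times$ is extended by $1\times g=1$, i.e. $(1+x)\curvearrowleft g=1+x\times g$ for $x\in\mathbb{C}[[\mathcal{P}]]$. Left action of $G^{inv}$ on $G$: $h\curvearrowright g=h\cdot g\cdot h^{-1}$. Translations $\lambda,\rho:G^{inv}\to G$: $\lambda(h)=I\cdot h$, $\rho(h)=h\cdot I$. For $h,h'\in G^{inv}$ put $h\star_l h'=h'\cdot(h\curvearrowleft\lambda(h'))$. Free product: for $k_a,k_b\in G^{inv}$, $k_a\boxtimes k_b:=k_b\star_l v\in G^{inv}$, where $v\in G^{inv}$ is the (unique, determined degree by degree) solution of $v=k_a\curvearrowleft\rho(k_b\curvearrowleft\lambda(v))$. *)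

(* Defs.v *)
From HB Require Import structures.
From mathcomp Require Import all_boot all_order all_algebra.
From mathcomp Require Import boolp classical_sets functions reals complex.

Set Implicit Arguments.
Unset Strict Implicit.
Unset Printing Implicit Defensive.

Import Order.TTheory GRing.Theory Num.Theory.
Local Open Scope ring_scope.

(* Planar operads in K-vector spaces without operators of arity 0: the spaces
   are indexed by all of nat, with P(0) the zero space.  The two sides of the
   unit and associativity axioms live in spaces P n, P n' whose arities are
   only propositionally equal, so they are compared in the total space
   {n & P n}. In op_compA, tagnat.sig1 and tagnat.sig2 give the block and the
   position in the block of an input of op_comp p q. *)
Structure operad (K : fieldType) := Operad {
  op :> nat -> lmodType K;
  op_id : op 1;
  op_comp : forall (n : nat) (k : 'I_n -> nat),
    op n -> (forall i, op (k i)) -> op (\sum_(i < n) k i)%N;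
  op_arity0 : forall x : op 0, x = 0;
  op_comp_linearl : forall (n : nat) (k : 'I_n -> nat) (q : forall i, op (k i)),
    linear (fun p : op n => op_comp p q);
  op_comp_linearr : forall (n : nat) (k : 'I_n -> nat) (p : op n)
      (q : forall i, op (k i)) (i : 'I_n),
    linear (fun u : op (k i) => op_comp p (dfwith q u));
  op_comp_id : forall (n : nat) (p : op n),
    Tagged op (op_comp p (fun _ : 'I_n => op_id)) = Tagged op p;
  op_id_comp : forall (n : nat) (p : op n),
    Tagged op (op_comp op_id (fun _ : 'I_1 => p)) = Tagged op p;
  op_compA : forall (n : nat) (k : 'I_n -> nat) (l : forall i, 'I_(k i) -> nat)
      (p : op n) (q : forall i, op (k i)) (r : forall i j, op (l i j)),
    Tagged op (op_comp (op_comp p q)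
      (fun s => r (tagnat.sig1 s) (tagnat.sig2 s))) =
    Tagged op (op_comp p (fun i => op_comp (q i) (r i)))
}.

Arguments op_id {K P} : rename.
Arguments op_comp {K P n k} p q : rename.

(* The family (x, y) indexed by 'I_2. *)
Definition arity2 (k q : nat) (i : 'I_2) : nat :=
  if val i is 0%N then k else q.

Definition ops2 (K : fieldType) (P : operad K) (k q : nat) (x : P k) (y : P q)
    (i : 'I_2) : P (arity2 k q i) :=
  match val i as j return P (if j is 0%N then k else q) with
  | 0%N => x
  | _.+1 => y
  end.

Definition op_comp2 (K : fieldType) (P : operad K) (m : P 2) (k q : nat)
    (x : P k) (y : P q) : P (\sum_(i < 2) arity2 k q i)%N :=
  op_comp m (ops2 x y).

Definition is_multiplication (K : fieldType) (P : operad K) (m : P 2) : Prop :=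
  Tagged (op P) (op_comp2 m op_id m) = Tagged (op P) (op_comp2 m m op_id).

(* [component N x] is x : P n transported to P N if n = N (and 0 otherwise). *)
Definition component (K : fieldType) (P : operad K) (N n : nat) (x : P n) : P N :=
  tagged_as (Tagged (op P) (0 : P N)) (Tagged (op P) x).

(* C[[P]]; the factor P 0 is the zero space. *)
Definition series (K : fieldType) (P : operad K) := forall n : nat, P n.

(* The unitization; (a, x) stands for a 1 + x. *)
Definition useries (K : fieldType) (P : operad K) := (K * series P)%type.

Definition series_id (K : fieldType) (P : operad K) : series P :=
  fun n => component n op_id.

(* The composition product; a term of arity N with all m_i >= 1 has n <= N and
   m_i <= N. *)
Definition scomp (K : fieldType) (P : operad K) (x y : series P) : series P :=
  fun N => \sum_(n < N.+1 | (0 < n)%N)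
    \sum_(m : {ffun 'I_n -> 'I_N.+1} |
            [forall i, 0 < m i]%N && (\sum_(i < n) m i == N)%N)
      component N (op_comp (x n) (fun i => y (m i))).

Definition smul (K : fieldType) (P : operad K) (m : P 2) (x y : series P) :
    series P :=
  fun N => \sum_(k < N.+1 | (0 < k)%N)
    \sum_(q < N.+1 | (0 < q)%N && (k + q == N)%N)
      component N (op_comp2 m (x k) (y q)).

Definition uone (K : fieldType) (P : operad K) : useries P :=
  (1, fun n => 0).

Definition useries_of (K : fieldType) (P : operad K) (x : series P) : useries P :=
  (0, x).

Definition umul (K : fieldType) (P : operad K) (m : P 2) (h h' : useries P) :
    useries P :=
  (h.1 * h'.1, fun n => h.1 *: h'.2 n + h'.1 *: h.2 n + smul m h.2 h'.2 n).

Definition in_Ginv (K : fieldType) (P : operad K) (h : useries P) : Prop :=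
  h.1 = 1.

(* The inverse of h in the group G^inv. *)
Definition uinv (K : fieldType) (P : operad K) (m : P 2) (h : useries P) :
    useries P :=
  xget (uone P) [set g | [/\ in_Ginv g, umul m h g = uone P
                           & umul m g h = uone P]].

(* The right action of G on G^inv. *)
Definition ract (K : fieldType) (P : operad K) (h : useries P) (g : series P) :
    useries P :=
  (h.1, scomp h.2 g).

(* The left action of G^inv on G and the translations: these products have
   degree 0 component 0, so their second projections lose nothing. *)
Definition lact (K : fieldType) (P : operad K) (m : P 2) (h : useries P)
    (g : series P) : series P :=
  (umul m (umul m h (useries_of g)) (uinv m h)).2.

Definition ltrans (K : fieldType) (P : operad K) (m : P 2) (h : useries P) :
    series P :=
  (umul m (useries_of (series_id P)) h).2.

Definition rtrans (K : fieldType) (P : operad K) (m : P 2) (h : useries P) :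
    series P :=
  (umul m h (useries_of (series_id P))).2.

Definition lstar (K : fieldType) (P : operad K) (m : P 2) (h h' : useries P) :
    useries P :=
  umul m h' (ract h (ltrans m h')).

(* The solution v of the fixed point equation defining the free product. *)
Definition box_sol (K : fieldType) (P : operad K) (m : P 2) (ka kb : useries P) :
    useries P :=
  xget (uone P) [set v | in_Ginv v /\
                         v = ract ka (rtrans m (ract kb (ltrans m v)))].

Definition boxtimes (K : fieldType) (P : operad K) (m : P 2)
    (ka kb : useries P) : useries P :=
  lstar m kb (box_sol m ka kb).

(* Main.v *)
Require Import Defs.
From mathcomp Require Import all_boot all_order all_algebra.
From mathcomp Require Import boolp classical_sets functions reals complex.

Set Implicit Arguments.
Unset Strict Implicit.
Unset Printing Implicit Defensive.

Import Order.TTheory GRing.Theory Num.Theory.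
Local Open Scope ring_scope.

(** Write K for the free product, v for the solution of its fixed point
    equation and w = kb <| lambda(v), where h <| g stands for the right action;
    thus K = v.w and v = ka <| rho(w).  Three facts are used: concatenation is
    associative, <| is a right action, i.e. (h <| g) <| g' = h <| (g x g') with
    x the composition product, and _ <| g is multiplicative for concatenation.
    As I is a left unit for x, the last fact gives lambda(h) x g = g.(h <| g).
    Substituting the equations of kb and ka,
      w = tb <| (lambda(kb) x lambda(v)) = tb <| (lambda(v).w)
        = tb <| lambda(K),
      v = ta <| (lambda(ka) x rho(w)) = ta <| (rho(w).v) = ta <| (w.I.v).
    On the other hand w = tb <| lambda(K) yields
      (tb.I.tb^-1) x lambda(K) = w.(I.v.w).w^-1 = w.I.v,
    so that acting by lambda(K) on (ta <| (tb.I.tb^-1)).tb gives v.w = K.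

    Both v and tb^-1 exist because their equations are contractions: the
    component of arity N of the right-hand side only depends on the components
    of the unknown of arity less than N (series_fixpoint).

    The identities between series all follow from a single one.  Let an operator
    p of arity n act on n series, mcomp p (y_1, ..., y_n).  Then concatenation
    is mcomp m, the composition product y x z is the sum over n of
    mcomp y_n (z, ..., z), and the associativity of the operad becomes the
    associativity of mcomp (mcompA).  Two conventions remove all the arity
    bookkeeping: an operator of the wrong arity has component 0, and an operator
    of arity 0 is 0.  Hence sums over tuples of arities with a prescribed total
    can be replaced by sums over all tuples bounded by any number that is large
    enough. *)

(** * Operators and their components *)

Lemma linear_fun0 (K : fieldType) (U V : lmodType K) (f : U -> V) :
  linear f -> f 0 = 0.
Proof.
by move=> /(_ (-1) 0 0); rewrite scaler0 addr0 scaleN1r addNr.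
Qed.

Lemma linear_sumr (K : fieldType) (U V : lmodType K) (f : U -> V) (I : finType)
    (A : pred I) (F : I -> U) :
  linear f -> f (\sum_(i | A i) F i) = \sum_(i | A i) f (F i).
Proof.
move=> lin_f; apply: (big_morph f) => [u v|]; last exact: linear_fun0.
by have := lin_f 1 u v; rewrite !scale1r.
Qed.

Lemma component_id (K : fieldType) (P : operad K) N (x : P N) :
  component N x = x.
Proof. exact: (@tagged_asE _ _ (Tagged (op P) (0 : P N))). Qed.

Lemma component_neq (K : fieldType) (P : operad K) N n (x : P n) :
  n != N -> component N x = 0.
Proof.
rewrite /component /tagged_as /= => /negP nN.
by case: eqP => // eqN; case: nN; rewrite eqN.
Qed.

Lemma component_congr (K : fieldType) (P : operad K) N n n' (x : P n)
    (x' : P n') :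
  Tagged (op P) x = Tagged (op P) x' -> component N x = component N x'.
Proof. by rewrite /component => ->. Qed.

Lemma Tagged_component (K : fieldType) (P : operad K) N n (x : P n) :
  n = N -> Tagged (op P) (component N x) = Tagged (op P) x.
Proof. by move=> <-; rewrite component_id. Qed.

Lemma component_linear (K : fieldType) (P : operad K) N n :
  linear (@component K P N n).
Proof.
move=> a u v; have [nN | nN] := eqVneq n N.
  by case: N / nN; rewrite !component_id.
by rewrite !component_neq // scaler0 addr0.
Qed.

(** Equality of the arguments in the total space suffices; this is how families
    whose arities agree only propositionally are compared. *)
Lemma eq_op_comp (K : fieldType) (P : operad K) n (p : P n)
    (k k' : 'I_n -> nat) (q : forall i, P (k i)) (q' : forall i, P (k' i)) :
    (forall i, Tagged (op P) (q i) = Tagged (op P) (q' i)) ->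
  Tagged (op P) (op_comp p q) = Tagged (op P) (op_comp p q').
Proof.
move=> eq_q; have eq_k : k = k'.
  by apply: funext => i; have /(congr1 (@tag _ _)) := eq_q i.
case: k' / eq_k in q' eq_q *.
suff -> : q = q' by [].
apply: functional_extensionality_dep => i.
exact: eq_from_Tagged (eq_q i).
Qed.

(** Multilinear expansion of a composition.  The index types vary with i, so the
    choices form a dependent function type; the element g0 makes that type
    inhabited. *)
Lemma op_comp_sum (K : fieldType) (P : operad K) n (k : 'I_n -> nat) (p : P n)
    (J : 'I_n -> finType) (Q : forall i, J i -> P (k i)) (g0 : forall i, J i) :
  op_comp p (fun i => \sum_j Q i j) =
    \sum_(f : {dffun forall i, J i}) op_comp p (fun i => Q i (f i)).
Proof.
(* Expand only the arguments listed in r, freezing the others along g. *)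
suff main (r : seq 'I_n) (g : forall i, J i) : uniq r ->
    op_comp p (fun i => if i \in r then \sum_j Q i j else Q i (g i)) =
    \sum_(f : {dffun forall i, J i} |
          [forall i, (i \notin r) ==> (f i == g i)])
      op_comp p (fun i => Q i (f i)).
  transitivity (op_comp p (fun i => if i \in enum 'I_n then \sum_j Q i j
                                    else Q i (g0 i))).
    congr op_comp; apply: functional_extensionality_dep => i.
    by rewrite mem_enum.
  rewrite main ?enum_uniq //; apply: eq_bigl => f.
  by apply/forallP => i; rewrite mem_enum.
elim: r g => [|a r IHr] g /=.
  move=> _; rewrite (big_pred1 (finfun g : {dffun forall i, J i})) => [|f].
    congr op_comp; apply: functional_extensionality_dep => i.
    by rewrite ffunE.
  apply/forallP/eqP => [eq_f | -> i]; last by rewrite ffunE eqxx.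
  by apply/ffunP => i; rewrite ffunE; apply/eqP/(eq_f i).
case/andP=> ar uniq_r.
pose q i := if i \in r then \sum_j Q i j else Q i (g i).
transitivity (op_comp p (dfwith q (\sum_j Q a j))).
  congr op_comp; apply: functional_extensionality_dep => i.
  case: dfwithP => [|j aj]; first by rewrite mem_head.
  by rewrite inE eq_sym (negPf aj).
have /= -> := linear_sumr predT (Q a) (op_comp_linearr p q (i := a)).
rewrite (partition_big (fun f : {dffun forall i, J i} => f a) xpredT) //=.
apply: eq_bigr => j _.
transitivity (op_comp p (fun i => if i \in r then \sum_j Q i j
                                  else Q i (dfwith g j i))).
  congr op_comp; apply: functional_extensionality_dep => i; rewrite /q.
  by case: dfwithP => [|b ab]; rewrite ?(negPf ar) ?dfwith_in ?dfwith_out.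
rewrite IHr //; apply: eq_bigl => f.
apply/forallP/andP => [eq_f | [/forallP eq_f /eqP fa] i].
  split; last by have := eq_f a; rewrite ar dfwith_in.
  apply/forallP => i; apply/implyP; rewrite inE negb_or => /andP[ia ir].
  by have := eq_f i; rewrite ir dfwith_out // eq_sym.
case: dfwithP => [|b ab]; first by rewrite fa eqxx implybT.
by have := eq_f b; rewrite inE negb_or eq_sym ab.
Qed.

Lemma component0 (K : fieldType) (P : operad K) N n :
  component N (0 : P n) = 0.
Proof. exact: linear_fun0 (@component_linear _ _ _ _). Qed.

Lemma op_comp0 (K : fieldType) (P : operad K) n (k : 'I_n -> nat) (p : P n)
    (q : forall i, P (k i)) i :
  q i = 0 -> op_comp p q = 0.
Proof.
move=> qi0; rewrite -[RHS](linear_fun0 (op_comp_linearr p q (i := i))).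
congr op_comp.
apply: functional_extensionality_dep => j.
by case: dfwithP.
Qed.

(** The arity of a composition is at least that of each of its arguments. *)
Lemma component_op_comp_gt (K : fieldType) (P : operad K) N n
    (k : 'I_n -> nat) (p : P n) (q : forall i, P (k i)) i :
  (N < k i)%N -> component N (op_comp p q) = 0.
Proof.
move=> Nk; apply: component_neq; rewrite neq_ltn; apply/orP; right.
by apply: leq_trans Nk _; rewrite (bigD1 i) //= leq_addr.
Qed.

(** Only the tuple M = a contributes.  If some a i exceeds N then no tuple does,
    but then the composition has arity greater than N. *)
Lemma sum_op_comp_component (K : fieldType) (P : operad K) N n
    (a : 'I_n -> nat) (p : P n) (t : forall i, P (a i)) :
  \sum_(M : {ffun 'I_n -> 'I_N.+1})
     component N (op_comp p (fun i => component (M i) (t i))) =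
  component N (op_comp p t).
Proof.
have [/forallP aN | /forallPn ] := boolP [forall i, (a i < N.+1)%N]; last first.
  case=> i; rewrite -leqNgt => Na.
  rewrite (component_op_comp_gt _ _ Na) big1 // => M _.
  rewrite (@op_comp0 _ _ _ _ _ _ i); last first.
    by rewrite component_neq // neq_ltn orbC (leq_ltn_trans _ Na) // -ltnS.
  exact: component0.
pose M0 : {ffun 'I_n -> 'I_N.+1} := [ffun i => inord (a i)].
have M0E i : M0 i = a i :> nat by rewrite ffunE inordK.
rewrite (bigD1 M0) //= [X in _ + X]big1 => [|M /eqP neM].
  rewrite [LHS]addr0; apply/component_congr/eq_op_comp => i.
  by rewrite Tagged_component.
have [eqM | ] := boolP [forall i, a i == M i].
  case: neM; apply/ffunP => i; apply: val_inj => /=.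
  by rewrite M0E (eqP (forallP eqM i)).
case/forallPn=> i nei.
by rewrite (@op_comp0 _ _ _ _ _ _ i) ?component0 //; apply: component_neq.
Qed.

(** * An operator acting on a family of series *)

Definition mcomp (K : fieldType) (P : operad K) n (p : P n)
    (ys : 'I_n -> series P) : series P :=
  fun N => \sum_(f : {ffun 'I_n -> 'I_N.+1})
             component N (op_comp p (fun i => ys i (f i))).

(** The extra tuples have an entry beyond N, hence a total arity beyond N. *)
Lemma mcompE (K : fieldType) (P : operad K) n (p : P n) (ys : 'I_n -> series P)
    N B :
    (N <= B)%N ->
  mcomp p ys N = \sum_(f : {ffun 'I_n -> 'I_B.+1})
                   component N (op_comp p (fun i => ys i (f i))).
Proof.
rewrite -ltnS => leNB.
rewrite [RHS](bigID (fun f : {ffun 'I_n -> 'I_B.+1} =>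
  [forall i, (f i < N.+1)%N])) /=.
rewrite [X in _ + X]big1 => [|f /forallPn]; last first.
  case=> i; rewrite -leqNgt => Nf.
  exact: (component_op_comp_gt p (fun i => ys i (f i)) Nf).
pose h (g : {ffun 'I_n -> 'I_N.+1}) := [ffun i => widen_ord leNB (g i)].
pose h' (f : {ffun 'I_n -> 'I_B.+1}) := [ffun i => inord (f i) : 'I_N.+1].
rewrite [RHS]addr0 [RHS](reindex_onto h h') => [|f /forallP fN]; last first.
  by apply/ffunP => i; rewrite !ffunE; apply: val_inj; rewrite /= inordK.
apply: eq_big => [g | g _].
  apply/esym/andP; split; first by apply/forallP => i; rewrite ffunE /=.
  by apply/eqP/ffunP => i; rewrite !ffunE inord_val.
apply/component_congr/eq_op_comp => i.
by rewrite ffunE.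
Qed.

(** Expanding the inner sums by multilinearity turns the left-hand side into a
    sum over families of tuples indexed by blocks, which correspond to the
    tuples indexed by all the inputs of the composed operator; the operad axiom
    then identifies the summands. *)
Lemma mcompA (K : fieldType) (P : operad K) n (k : 'I_n -> nat) (p : P n)
    (q : forall i, P (k i)) (zs : forall i, 'I_(k i) -> series P) :
  mcomp p (fun i => mcomp (q i) (zs i)) =
  mcomp (op_comp p q) (fun s => zs (tagnat.sig1 s) (tagnat.sig2 s)).
Proof.
apply: functional_extensionality_dep => N.
pose J i : finType := {ffun 'I_(k i) -> 'I_N.+1}.
pose t (F : {dffun forall i, J i}) i := op_comp (q i) (fun j => zs i j (F i j)).
transitivity (\sum_(F : {dffun forall i, J i}) component N (op_comp p (t F))).
  under [RHS]eq_bigr => F _ do rewrite -(sum_op_comp_component N p (t F)).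
  rewrite exchange_big; apply: eq_bigr => M _ /=.
  rewrite -(linear_sumr _ _ (@component_linear _ _ _ _)).
  congr component; rewrite -(op_comp_sum p (fun i (F : J i) =>
    component (M i) (op_comp (q i) (fun j => zs i j (F j))))).
    congr op_comp; apply: functional_extensionality_dep => i.
    by apply: mcompE; rewrite -ltnS.
  by move=> i; exact: [ffun => ord0].
pose h (F : {dffun forall i, J i}) : {ffun 'I_(\sum_i k i) -> 'I_N.+1} :=
  [ffun s => F (tagnat.sig1 s) (tagnat.sig2 s)].
pose h' (f : {ffun 'I_(\sum_i k i) -> 'I_N.+1}) : {dffun forall i, J i} :=
  finfun (fun i => [ffun j => f (@tagnat.Rank _ k i j)] : J i).
rewrite /mcomp (reindex h).
  apply: eq_bigr => F _; apply: component_congr.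
  rewrite -op_compA; apply: eq_op_comp => s.
  by rewrite ffunE.
exists h' => [F _ | f _].
  apply/ffunP => i; apply/ffunP => j; rewrite !ffunE.
  by rewrite /tagnat.sig1 /tagnat.sig2 /tagnat.Rank tagnat.rankK.
by apply/ffunP => s; rewrite !ffunE tagnat.sig2K.
Qed.

Lemma mcomp_congr (K : fieldType) (P : operad K) n n' (p : P n) (p' : P n')
    (ys : 'I_n -> series P) (ys' : 'I_n' -> series P) :
    Tagged (op P) p = Tagged (op P) p' ->
    (forall (i : 'I_n) (i' : 'I_n'), i = i' :> nat -> ys i = ys' i') ->
  mcomp p ys = mcomp p' ys'.
Proof.
move=> eq_p; have eq_n : n = n' by exact: (congr1 (@tag _ _) eq_p).
case: n' / eq_n in p' ys' eq_p * => eq_ys.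
rewrite (eq_from_Tagged eq_p); congr mcomp.
by apply: funext => i; apply: eq_ys.
Qed.

Lemma mcomp_linear (K : fieldType) (P : operad K) n (ys : 'I_n -> series P) N :
  linear (fun p : P n => mcomp p ys N).
Proof.
move=> a p p'; rewrite /mcomp scaler_sumr -big_split /=.
apply: eq_bigr => f _; rewrite -component_linear.
by congr component; apply: op_comp_linearl.
Qed.

Lemma mcomp0 (K : fieldType) (P : operad K) n (ys : 'I_n -> series P) N :
  mcomp 0 ys N = 0.
Proof. exact: linear_fun0 (mcomp_linear ys N). Qed.

(** An argument of arity 0 vanishes because P 0 = 0. *)
Lemma op_comp_series0 (K : fieldType) (P : operad K) n (p : P n)
    (ys : 'I_n -> series P) (f : 'I_n -> nat) i :
  f i = 0%N -> op_comp p (fun i => ys i (f i)) = 0.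
Proof.
move=> fi0; apply: (@op_comp0 _ _ _ _ _ _ i).
by case: (f i) / (esym fi0); apply: op_arity0.
Qed.

(** A nonzero term has n arguments of arity at least 1. *)
Lemma mcomp_gt (K : fieldType) (P : operad K) n (p : P n)
    (ys : 'I_n -> series P) N :
  (N < n)%N -> mcomp p ys N = 0.
Proof.
move=> Nn; apply: big1 => f _.
have [f_gt0 | /forallPn] := boolP [forall i, (0 < f i)%N]; last first.
  case=> i; rewrite -eqn0Ngt => /eqP fi0.
  by rewrite (@op_comp_series0 _ _ _ _ ys (fun j => f j) i fi0) component0.
apply: component_neq; rewrite neq_ltn; apply/orP; right.
apply: leq_trans Nn _; rewrite -[leqLHS]card_ord -sum1_card.
by apply: leq_sum => i _; apply: (forallP f_gt0).
Qed.

(** The positivity and total arity conditions in the definition of the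
    composition product only discard zero terms, and so does the bound
    n <= N. *)
Lemma scompE (K : fieldType) (P : operad K) (x y : series P) N B :
    (N <= B)%N ->
  scomp x y N = \sum_(n < B.+1) mcomp (x n) (fun _ => y) N.
Proof.
move=> leNB; transitivity (\sum_(n < N.+1) mcomp (x n) (fun _ => y) N).
  rewrite /scomp big_mkcond; apply: eq_bigr => n _.
  case: posnP => [n0 | _].
    suff -> : x n = 0 by rewrite mcomp0.
    by case: (nat_of_ord n) / (esym n0); apply: op_arity0.
  rewrite big_mkcond; apply: eq_bigr => f _.
  case: ifPn => // /nandP[/forallPn | neN]; last by rewrite component_neq.
  case=> i; rewrite -eqn0Ngt => /eqP fi0.
  rewrite (@op_comp_series0 _ _ _ _ (fun _ => y) (fun j => f j) i fi0).
  by rewrite component0.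
rewrite (big_ord_widen B.+1 (fun n => mcomp (x n) (fun _ => y) N)) //.
rewrite big_mkcond; apply: eq_bigr => n _.
by case: ltnP => // Nn; rewrite mcomp_gt.
Qed.

(** The terms with b <> a vanish; if a > N, so does the right-hand side. *)
Lemma sum_mcomp_component (K : fieldType) (P : operad K) a (t : P a)
    (g : series P) N :
  \sum_(b < N.+1) mcomp (component b t) (fun _ => g) N =
  mcomp t (fun _ => g) N.
Proof.
have [aN | Na] := ltnP a N.+1.
  rewrite (bigD1 (Ordinal aN)) //= component_id [X in _ + X]big1 ?addr0 //.
  move=> b neb; rewrite component_neq ?mcomp0 //.
  by apply: contraNneq neb => ab; apply/eqP/val_inj.
rewrite mcomp_gt // big1 // => b _.
by rewrite component_neq ?mcomp0 // neq_ltn orbC (leq_trans (ltn_ord b)).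
Qed.

(** Right composition commutes with operators.  Both sides reduce to the sum,
    over the arities a i of the components of ys i that occur, of the operators
    op_comp p (ys i (a i)) acting on copies of g. *)
Lemma mcomp_scomp (K : fieldType) (P : operad K) n (p : P n)
    (ys : 'I_n -> series P) (g : series P) :
  scomp (mcomp p ys) g = mcomp p (fun i => scomp (ys i) g).
Proof.
apply: functional_extensionality_dep => N.
pose t (a : {ffun 'I_n -> 'I_N.+1}) := op_comp p (fun i => ys i (a i)).
transitivity (\sum_a mcomp (t a) (fun _ => g) N).
  rewrite (scompE _ _ (leqnn N)).
  under [RHS]eq_bigr => a _ do rewrite -sum_mcomp_component.
  rewrite exchange_big; apply: eq_bigr => b _ /=.
  rewrite (@mcompE _ _ _ _ _ b N) -1?ltnS //.
  exact: linear_sumr (mcomp_linear _ _).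
under eq_bigr => a _ do
  rewrite -(mcompA p (fun i => ys i (a i)) (fun _ _ => g)).
rewrite exchange_big; apply: eq_bigr => f _ /=.
rewrite -(linear_sumr _ _ (@component_linear _ _ _ _)).
congr component; rewrite -(op_comp_sum p (fun i (a : 'I_N.+1) =>
  mcomp (ys i a) (fun _ => g) (f i))); last by move=> i; exact: ord0.
congr op_comp; apply: functional_extensionality_dep => i.
by rewrite (@scompE _ _ _ _ _ N) // -ltnS.
Qed.

(** * The composition product *)

Lemma scompA (K : fieldType) (P : operad K) (x y z : series P) :
  scomp (scomp x y) z = scomp x (scomp y z).
Proof.
apply: functional_extensionality_dep => N.
rewrite (scompE x _ (leqnn N)).
under [RHS]eq_bigr => n _ do
  rewrite -(mcomp_scomp (x n) (fun _ => y)) (scompE _ _ (leqnn N)).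
rewrite exchange_big (scompE _ _ (leqnn N)); apply: eq_bigr => b _ /=.
rewrite (@scompE _ _ x y b N) -1?ltnS //.
exact: linear_sumr (mcomp_linear _ _).
Qed.

Lemma mcomp_id (K : fieldType) (P : operad K) (g : series P) :
  mcomp op_id (fun _ => g) = g.
Proof.
apply: functional_extensionality_dep => N.
rewrite /mcomp (reindex (fun a : 'I_N.+1 => [ffun _ : 'I_1 => a])); last first.
  exists (fun f : {ffun 'I_1 -> 'I_N.+1} => f ord0) => [a _ | f _].
    by rewrite ffunE.
  by apply/ffunP => i; rewrite ffunE (ord1 i).
under eq_bigr => a _.
  rewrite (@component_congr _ _ _ _ a _ (g a)).
    over.
  rewrite -[RHS]op_id_comp; apply: eq_op_comp => i.
  by rewrite ffunE.
rewrite (bigD1 ord_max) //= component_id [X in _ + X]big1 ?addr0 // => a nea.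
by apply: component_neq; apply: contraNneq nea => aN; apply/eqP/val_inj.
Qed.

Lemma scomp_idl (K : fieldType) (P : operad K) (g : series P) :
  scomp (series_id P) g = g.
Proof.
apply: functional_extensionality_dep => N.
(* The bound N + 1 makes the term n = 1 present even for N = 0. *)
rewrite (scompE _ _ (leqnSn N)) (bigD1 (Ordinal (isT : 1 < N.+2)%N)) //=.
rewrite /series_id component_id mcomp_id [X in _ + X]big1 ?addr0 // => n nen.
rewrite component_neq ?mcomp0 //.
by apply: contraNneq nen => n1; apply/eqP/val_inj.
Qed.

(** * The concatenation product *)

Definition series2 (K : fieldType) (P : operad K) (x y : series P) (i : 'I_2) :
    series P :=
  if val i is 0%N then x else y.

Lemma smulE (K : fieldType) (P : operad K) (m : P 2) (x y : series P) :
  smul m x y = mcomp m (series2 x y).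
Proof.
apply: functional_extensionality_dep => N.
pose h (ab : 'I_N.+1 * 'I_N.+1) : {ffun 'I_2 -> 'I_N.+1} :=
  [ffun i => if val i is 0%N then ab.1 else ab.2].
rewrite /mcomp (reindex h); last first.
  exists (fun f : {ffun 'I_2 -> 'I_N.+1} => (f ord0, f ord_max)).
    move=> [a b] _.
    by rewrite !ffunE.
  move=> f _; apply/ffunP => i; rewrite ffunE /=.
  by case: i => [[|[|//]] lt_i] /=; congr (f _); apply: val_inj.
rewrite -(pair_bigA _ (fun a b => component N
  (op_comp m (fun i => series2 x y i (h (a, b) i))))) /=.
have eqt (a b : 'I_N.+1) :
    component N (op_comp m (fun i => series2 x y i (h (a, b) i))) =
    component N (op_comp2 m (x a) (y b)).
  apply/component_congr/eq_op_comp => i.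
  by rewrite ffunE; case: i => [[|[|//]] lt_i].
(* The terms left out by the definition of the concatenation product vanish. *)
rewrite /smul big_mkcond; apply: eq_bigr => a _.
case: posnP => [a0 | _].
  rewrite big1 // => b _; rewrite eqt /op_comp2.
  rewrite (@op_comp0 _ _ _ _ _ _ ord0) ?component0 //=.
  rewrite /ops2 /=.
  by case: (nat_of_ord a) / (esym a0); apply: op_arity0.
rewrite big_mkcond; apply: eq_bigr => b _; rewrite eqt.
case: ifPn => // /nandP[|neN]; last first.
  by rewrite component_neq // !big_ord_recl big_ord0 addn0.
rewrite -eqn0Ngt => /eqP b0.
rewrite /op_comp2 (@op_comp0 _ _ _ _ _ _ ord_max) ?component0 //=.
rewrite /ops2 /=.
by case: (nat_of_ord b) / (esym b0); apply: op_arity0.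
Qed.

Lemma op_comp2_linearl (K : fieldType) (P : operad K) (m : P 2) k q (v : P q) :
  linear (fun u : P k => op_comp2 m u v).
Proof.
have E (u : P k) :
    ops2 u v = dfwith (ops2 0 v) (u : P (arity2 k q ord0)).
  apply: functional_extensionality_dep => i; case: dfwithP => // j.
  by case: j => [[|j] lt_j].
move=> a u u'; rewrite /op_comp2 (E (a *: u + u')) (E u) (E u').
exact: (op_comp_linearr m (ops2 0 v) (i := ord0)).
Qed.

Lemma op_comp2_linearr (K : fieldType) (P : operad K) (m : P 2) k q (u : P k) :
  linear (fun v : P q => op_comp2 m u v).
Proof.
have E (v : P q) :
    ops2 u v = dfwith (ops2 u 0) (v : P (arity2 k q ord_max)).
  apply: functional_extensionality_dep => i; case: dfwithP => // j.
  by case: j => [[|[|//]] lt_j].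
move=> a v v'; rewrite /op_comp2 (E (a *: v + v')) (E v) (E v').
exact: (op_comp_linearr m (ops2 u 0) (i := ord_max)).
Qed.

Lemma smul_linearl (K : fieldType) (P : operad K) (m : P 2) a
    (x x' y : series P) N :
  smul m (fun n => a *: x n + x' n) y N = a *: smul m x y N + smul m x' y N.
Proof.
rewrite /smul scaler_sumr -big_split; apply: eq_bigr => k _ /=.
rewrite scaler_sumr -big_split; apply: eq_bigr => q _ /=.
by rewrite -component_linear; congr component; apply: op_comp2_linearl.
Qed.

Lemma smul_linearr (K : fieldType) (P : operad K) (m : P 2) a
    (x y y' : series P) N :
  smul m x (fun n => a *: y n + y' n) N = a *: smul m x y N + smul m x y' N.
Proof.
rewrite /smul scaler_sumr -big_split; apply: eq_bigr => k _ /=.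
rewrite scaler_sumr -big_split; apply: eq_bigr => q _ /=.
by rewrite -component_linear; congr component; apply: op_comp2_linearr.
Qed.

Lemma scomp_linear (K : fieldType) (P : operad K) a (x x' g : series P) N :
  scomp (fun n => a *: x n + x' n) g N = a *: scomp x g N + scomp x' g N.
Proof.
rewrite !(scompE _ _ (leqnn N)) scaler_sumr -big_split.
by apply: eq_bigr => n _; apply: mcomp_linear.
Qed.

(** When the series are listed by natural numbers, the inputs of block i of the
    composed operator are those following the inputs of the earlier blocks. *)
Lemma mcompA_nat (K : fieldType) (P : operad K) n (k : 'I_n -> nat) (p : P n)
    (q : forall i, P (k i)) (W : nat -> series P) :
  mcomp p (fun i =>
    mcomp (q i) (fun j => W (\sum_(i' < n | i' < i) k i' + j)%N)) =
  mcomp (op_comp p q) (fun s => W s).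
Proof.
rewrite mcompA; congr mcomp; apply: funext => s; congr W.
by rewrite -tagnat.rankEsum tagnat.sigK.
Qed.

(** Both sides are the series x, y, z fed to an operator of arity 3, and these
    two operators agree since m is a multiplication; on either side the factor
    that is not a product is seen as the identity operator acting on it. *)
Lemma smulA (K : fieldType) (P : operad K) (m : P 2) (x y z : series P) :
    is_multiplication m ->
  smul m (smul m x y) z = smul m x (smul m y z).
Proof.
move=> hm; pose W := nth z [:: x; y].
transitivity (mcomp (op_comp2 m m op_id) (fun s => W s)).
  rewrite -mcompA_nat smulE; congr mcomp; apply: funext => i.
  rewrite big_mkcond !big_ord_recl big_ord0.
  case: i => [[|[|//]] lt_i] /=.
    rewrite smulE; apply: mcomp_congr => //= j j' <-.
    by case: j => [[|[|//]] lt_j].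
  rewrite -[LHS]mcomp_id; apply: mcomp_congr => //= j j' <-.
  by rewrite (ord1 j).
transitivity (mcomp (op_comp2 m op_id m) (fun s => W s)).
  by apply: mcomp_congr => // i i' ->.
rewrite -mcompA_nat smulE; congr mcomp; apply: funext => i.
rewrite big_mkcond !big_ord_recl big_ord0.
case: i => [[|[|//]] lt_i] /=.
  rewrite -[RHS]mcomp_id; apply: mcomp_congr => //= j j' ->.
  by rewrite (ord1 j').
rewrite smulE; apply: mcomp_congr => //= j j' ->.
by case: j' => [[|[|//]] lt_j'].
Qed.

Lemma scomp_smul (K : fieldType) (P : operad K) (m : P 2) (x y g : series P) :
  scomp (smul m x y) g = smul m (scomp x g) (scomp y g).
Proof.
rewrite !smulE mcomp_scomp; congr mcomp; apply: funext => i.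
by case: i => [[|[|//]] lt_i].
Qed.

(** * The unitization and the right action *)

Lemma smul0l (K : fieldType) (P : operad K) (m : P 2) (y : series P) N :
  smul m (fun n => 0) y N = 0.
Proof.
rewrite /smul big1 // => k _; rewrite big1 // => q _.
rewrite /op_comp2 (@op_comp0 _ _ _ _ _ _ ord0) //; exact: component0.
Qed.

Lemma smul0r (K : fieldType) (P : operad K) (m : P 2) (x : series P) N :
  smul m x (fun n => 0) N = 0.
Proof.
rewrite /smul big1 // => k _; rewrite big1 // => q _.
rewrite /op_comp2 (@op_comp0 _ _ _ _ _ _ ord_max) //; exact: component0.
Qed.

Lemma smul_umull (K : fieldType) (P : operad K) (m : P 2) (g h : useries P)
    (y : series P) N :
  smul m (umul m g h).2 y N =
    g.1 *: smul m h.2 y N + h.1 *: smul m g.2 y N + smul m (smul m g.2 h.2) y N.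
Proof.
rewrite -addrA -!smul_linearl; congr (smul m _ y N).
by apply: functional_extensionality_dep => n; rewrite /umul /= addrA.
Qed.

Lemma smul_umulr (K : fieldType) (P : operad K) (m : P 2) (g h : useries P)
    (x : series P) N :
  smul m x (umul m g h).2 N =
    g.1 *: smul m x h.2 N + h.1 *: smul m x g.2 N + smul m x (smul m g.2 h.2) N.
Proof.
rewrite -addrA -!smul_linearr; congr (smul m x _ N).
by apply: functional_extensionality_dep => n; rewrite /umul /= addrA.
Qed.

Lemma umulA (K : fieldType) (P : operad K) (m : P 2) (g h k : useries P) :
    is_multiplication m ->
  umul m (umul m g h) k = umul m g (umul m h k).
Proof.
move=> hm; congr pair; first by rewrite /= mulrA.
apply: functional_extensionality_dep => n.
rewrite smul_umull smul_umulr smulA //=.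
rewrite !scalerDr !scalerA !addrA (mulrC k.1 g.1) (mulrC k.1 h.1).
by rewrite [RHS](ACl (1*2*4*6*3*5*7)%AC).
Qed.

Lemma umul1r (K : fieldType) (P : operad K) (m : P 2) (h : useries P) :
  umul m h (uone P) = h.
Proof.
case: h => a x; congr pair; first exact: mulr1.
apply: functional_extensionality_dep => n /=.
by rewrite scaler0 scale1r add0r smul0r addr0.
Qed.

Lemma umul1l (K : fieldType) (P : operad K) (m : P 2) (h : useries P) :
  umul m (uone P) h = h.
Proof.
case: h => a x; congr pair; first exact: mul1r.
apply: functional_extensionality_dep => n /=.
by rewrite scaler0 scale1r addr0 smul0l addr0.
Qed.

Lemma ract_umul (K : fieldType) (P : operad K) (m : P 2) (h h' : useries P)
    (g : series P) :
  ract (umul m h h') g = umul m (ract h g) (ract h' g).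
Proof.
congr pair; apply: functional_extensionality_dep => n /=.
rewrite -scomp_smul -addrA -!scomp_linear; congr (scomp _ g n).
by apply: functional_extensionality_dep => k; rewrite addrA.
Qed.

Lemma ractA (K : fieldType) (P : operad K) (h : useries P) (g g' : series P) :
  ract (ract h g) g' = ract h (scomp g g').
Proof. by rewrite /ract scompA. Qed.

Lemma ract_id (K : fieldType) (P : operad K) (g : series P) :
  ract (useries_of (series_id P)) g = useries_of g.
Proof. by rewrite /ract scomp_idl. Qed.

Lemma ract_uone (K : fieldType) (P : operad K) (g : series P) :
  ract (uone P) g = uone P.
Proof.
congr pair; apply: functional_extensionality_dep => N.
by rewrite (scompE _ _ (leqnn N)) big1 // => n _; apply: mcomp0.
Qed.

Lemma useries_of_snd (K : fieldType) (P : operad K) (h : useries P) :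
  h.1 = 0 -> useries_of h.2 = h.
Proof. by case: h => a x /= ->. Qed.

Lemma scomp_snd (K : fieldType) (P : operad K) (h : useries P) (g : series P) :
  scomp h.2 g = (ract h g).2.
Proof. by []. Qed.

Lemma useries_of_ltrans (K : fieldType) (P : operad K) (m : P 2)
    (h : useries P) :
  useries_of (ltrans m h) = umul m (useries_of (series_id P)) h.
Proof. by apply: useries_of_snd; rewrite /= mul0r. Qed.

Lemma useries_of_rtrans (K : fieldType) (P : operad K) (m : P 2)
    (h : useries P) :
  useries_of (rtrans m h) = umul m h (useries_of (series_id P)).
Proof. by apply: useries_of_snd; rewrite /= mulr0. Qed.

(** The right action is multiplicative and I is a left unit for composition. *)
Lemma scomp_ltrans (K : fieldType) (P : operad K) (m : P 2) (h : useries P)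
    (g : series P) :
  scomp (ltrans m h) g = (umul m (useries_of g) (ract h g)).2.
Proof. by rewrite scomp_snd ract_umul ract_id. Qed.

(** * Fixed points of contractions, inverses and the free product *)

(** Iterating F from any series, the component of arity N is constant from the
    step N + 1 on; the fixed point collects these limits. *)
Lemma series_fixpoint (K : fieldType) (P : operad K)
    (F : series P -> series P) :
    (forall N x y, (forall k, (k < N)%N -> x k = y k) -> F x N = F y N) ->
  exists v, v = F v.
Proof.
move=> F_loc; pose it n : series P := iter n F (fun _ => 0).
have it_stable N a b : (N < a)%N -> (N < b)%N -> it a N = it b N.
  elim/ltn_ind: N a b => N IHN [|a] [|b] // Na Nb.
  by apply: F_loc => k kN; apply: IHN => //; apply: leq_trans kN _.
exists (fun n => it n.+1 n); apply: functional_extensionality_dep => N.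
by apply: F_loc => k kN; apply: it_stable.
Qed.

Lemma smul_localr (K : fieldType) (P : operad K) (m : P 2) (x y y' : series P)
    N :
  (forall k, (k < N)%N -> y k = y' k) -> smul m x y N = smul m x y' N.
Proof.
move=> eq_y; apply: eq_bigr => k k_gt0.
apply: eq_bigr => q /andP[_ /eqP kqN].
by rewrite eq_y // -[in ltnRHS]kqN -[ltnLHS]add0n ltn_add2r.
Qed.

Lemma smul_locall (K : fieldType) (P : operad K) (m : P 2) (x x' y : series P)
    N :
  (forall k, (k < N)%N -> x k = x' k) -> smul m x y N = smul m x' y N.
Proof.
move=> eq_x; apply: eq_bigr => k _.
apply: eq_bigr => q /andP[q_gt0 /eqP kqN].
by rewrite eq_x // -[in ltnRHS]kqN -[ltnLHS]addn0 ltn_add2l.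
Qed.

Lemma scomp_local (K : fieldType) (P : operad K) (x y y' : series P) N :
  (forall k, (k <= N)%N -> y k = y' k) -> scomp x y N = scomp x y' N.
Proof.
move=> eq_y; apply: eq_bigr => n _; apply: eq_bigr => f _.
congr component; congr op_comp; apply: functional_extensionality_dep => i.
by apply: eq_y; rewrite -ltnS.
Qed.

(** A left and a right inverse of 1 + x are 1 + l and 1 + r, where l and r solve
    l = - (x + l.x) and r = - (x + x.r); both equations are contractions because
    x and the unknown start in arity 1. *)
Lemma uinvP (K : fieldType) (P : operad K) (m : P 2) (h : useries P) :
  is_multiplication m -> in_Ginv h -> umul m h (uinv m h) = uone P.
Proof.
move=> hm h1.
have [r hr] : exists r, umul m h (1, r) = uone P.
  have [N x y eq_xy | r rE] := @series_fixpoint _ P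
    (fun r n => - (h.2 n + smul m h.2 r n)).
    by rewrite (smul_localr _ _ eq_xy).
  exists r; rewrite /umul h1; congr pair; first exact: mulr1.
  apply: functional_extensionality_dep => n /=.
  by rewrite !scale1r -addrA {1}rE addNr.
have [l lh] : exists l, umul m (1, l) h = uone P.
  have [N x y eq_xy | l lE] := @series_fixpoint _ P
    (fun l n => - (h.2 n + smul m l h.2 n)).
    by rewrite (smul_locall _ _ eq_xy).
  exists l; rewrite /umul h1; congr pair; first exact: mulr1.
  apply: functional_extensionality_dep => n /=.
  by rewrite !scale1r [X in X + _]addrC -addrA {1}lE addNr.
rewrite /uinv; case: xgetP => [g _ [] // | no_inv].
case: (no_inv (1, r)); split=> //.
suff <- : (1, l) = (1, r) :> useries P by [].
by rewrite -[LHS](umul1r m) -hr -umulA // lh umul1l.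
Qed.

(** The defining equation of v is a contraction: the translations multiply by I,
    which shifts the arity by 1, and the composition product only uses
    components of its right factor up to the arity considered. *)
Lemma box_solP (K : fieldType) (P : operad K) (m : P 2) (ka kb : useries P)
    (v := box_sol m ka kb) :
  in_Ginv ka -> v = ract ka (rtrans m (ract kb (ltrans m v))).
Proof.
move=> ka1.
have [N x y eq_xy | s sE] := @series_fixpoint _ P (fun s =>
    scomp ka.2 (rtrans m (ract kb (ltrans m (1, s))))).
  apply: scomp_local => k kN; rewrite /rtrans /=.
  rewrite !scale0r !addr0.
  have eq_ract q : (q <= N)%N ->
      scomp kb.2 (ltrans m (1, x)) q = scomp kb.2 (ltrans m (1, y)) q.
    move=> qN; apply: scomp_local => j jq; rewrite /ltrans /= !scale0r.
    congr (_ + _); apply: smul_localr => l lj.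
    by apply: eq_xy; apply: leq_trans lj (leq_trans jq qN).
  congr (_ + _); apply: smul_locall => q qk.
  by apply: eq_ract; apply: leq_trans (ltnW qk) kN.
rewrite {}/v /box_sol; case: xgetP => [v _ [] // | no_sol].
case: (no_sol (1, s)); split=> //.
by rewrite /ract ka1; congr pair.
Qed.

Theorem theorem3p12 (R : realType) (P : operad R[i]) (m : P 2)
    (hm : is_multiplication m) (ka kb ta tb : useries P)
    (hka : in_Ginv ka) (hkb : in_Ginv kb) (hta : in_Ginv ta) (htb : in_Ginv tb)
    (eqa : ka = ract ta (ltrans m ka)) (eqb : kb = ract tb (ltrans m kb)) :
  boxtimes m ka kb =
    ract (umul m (ract ta (lact m tb (series_id P))) tb)
         (ltrans m (boxtimes m ka kb)).
Proof.
pose v := box_sol m ka kb; pose w := ract kb (ltrans m v).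
pose I := useries_of (series_id P).
have vE : v = ract ka (rtrans m w) by exact: box_solP.
have -> : boxtimes m ka kb = umul m v w by [].
set L := ltrans m (umul m v w).
have wE : w = ract tb L.
  rewrite {1}/w eqb ractA scomp_ltrans useries_of_ltrans.
  by rewrite umulA.
have vE' : v = ract ta (umul m (umul m w I) v).2.
  rewrite {1}vE eqa ractA scomp_ltrans -vE.
  by rewrite useries_of_rtrans.
rewrite ract_umul -wE {1}vE'; congr umul.
rewrite ractA; congr ract.
rewrite scomp_snd !ract_umul ract_id -wE useries_of_ltrans.
by rewrite !umulA // wE -ract_umul uinvP // ract_uone umul1r -wE.
Qed.
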